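(* Let $G=\Gamma(S)$ be the zero-divisor graph of a zero-divisor semigroup $S$. Let $s,t$ be two (distinct) vertices of $G$ such that $T_s\neq\emptyset$, $T_t\neq\emptyset$, $s^2=0$ and $t^2=0$, where $T_s$ (respectively $T_t$) denotes the set of end vertices of $G$ adjacent to $s$ (respectively $t$). Then the following conclusions hold: (1) $T_sT_t\subseteq N(s)\cap N(t)$, and $sS=\{0,s\}$, $tS=\{0,t\}$. (2) If one of the following conditions holds, then $T_s\cup\{0\}$ is a reduced sub-semigroup of $S$: (I) $u^2=0$ for all vertices $u\in N(s)\cap K(G)$, where $K(G)$ is the core of $G$; (II) the edge $s-t$ is not contained in any quadrilateral (cycle of length 4) of $G$.
   Context: All semigroups are commutative, written multiplicatively, and have a zero element $0$ with $0x=0$ for all $x$. A zero-divisor semigroup is such a semigroup $S$ in which every element is a zero-divisor (an element $x$ with $xy=0$ for some nonzero $y\in S$). The zero-divisor graph $\Gamma(S)$ is the undirected simple graph whose vertices are the nonzero zero-divisors of $S$ (here: all of $S\setminus\{0\}$), with distinct vertices $x,y$ adjacent if and only if $xy=0$. An end vertex is a vertex of degree one. $N(x)$ is the set of vertices adjacent to $x$. For subsets $A,B\subseteq S$, $AB=\{ab: a\in A, b\in B\}$. The core $K(G)$ of $G$ is the largest subgraph of $G$ every edge of which is an edge of a cycle in $G$. A semigroup with zero is reduced if it has no nonzero nilpotent elements.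
   Formalization: The case where G is the single edge K_2 is excluded: for S={0,s,t} with all products 0, all hypotheses hold but T_sT_t={0} is not contained in N(s)∩N(t) and sS={0}; this is the only semigroup removed. *)

(* Defs.v *)
From HB Require Import structures.
From mathcomp Require Import all_boot.
From mathcomp Require Import boolp classical_sets functions cardinality.

Set Implicit Arguments.
Unset Strict Implicit.
Unset Printing Implicit Defensive.

Local Open Scope classical_set_scope.
Local Open Scope card_scope.
Local Open Scope group_scope.

HB.mixin Record Semigroup_isComZSemigroup S of Semigroup S := {
  zero : S;
  mulgC : commutative (@mul S);
  mul0g : left_zero zero (@mul S)
}.

#[short(type="comZSemigroupType")]
HB.structure Definition ComZSemigroup :=
  {S of Semigroup_isComZSemigroup S & Semigroup S}.

Notation "0" := (@zero _) : group_scope.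

Section Semigroups.
Variable S : comZSemigroupType.
Implicit Types (x y : S) (A B : set S).

Definition zero_divisor x := exists2 y, y != 0 & x * y = 0.

Definition zero_divisor_semigroup := forall x, zero_divisor x.

Definition mulset A B : set S := [set x * y | x in A & y in B].

Definition subsemigroup A :=
  A !=set0 /\ forall x y, A x -> A y -> A (x * y).

(* iter n (mul x) x is the (n+1)-st power of x; a semigroup has no x ^+ 0. *)
Definition nilpotent x := exists n, iter n (mul x) x = 0.

Definition reduced_subsemigroup A :=
  [/\ subsemigroup A, A 0 & forall x, A x -> nilpotent x -> x = 0].

End Semigroups.

Record graph (T : eqType) := Graph {
  vertex : set T;
  edge : rel T;
  edge_sym : symmetric edge;
  edge_irrefl : irreflexive edge;
  edge_vertex : forall x y, edge x y -> vertex x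
}.

Section Graphs.
Variables (T : choiceType) (G : graph T).
Implicit Types (x y : T) (c : seq T) (H K : graph T).

Definition neighbors x : set T := [set y | edge G x y].

Definition has_degree x n := neighbors x #= `I_n.

Definition end_vertex x := vertex G x /\ has_degree x 1.

Definition end_neighbors x : set T :=
  [set a | edge G x a /\ end_vertex a].

(* Γ(S) = K2 for S = {0, s, t} with all products 0. There s and t are the end
   vertices adjacent to each other, and s S = {0}: results about the end
   vertices attached to distinct s and t tacitly exclude this graph. *)
Definition is_K2 :=
  exists x y, [/\ x <> y, vertex G = [set x; y] & edge G x y].

Definition is_cycle c := (2 < size c)%N /\ ucycle (edge G) c.

Definition cycle_edge c x y :=
  [&& x \in c, y \in c & (next c x == y) || (next c y == x)].

Definition in_quadrilateral x y :=
  exists c, [/\ is_cycle c, size c = 4 & cycle_edge c x y].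

Definition subgraph H K :=
  vertex H `<=` vertex K /\ forall x y, edge H x y -> edge K x y.

(* Isolated vertices are excluded, since the condition on edges says nothing
   about them: without this clause, every vertex of G would be in the core. *)
Definition cyclic_subgraph H :=
  [/\ subgraph H G,
      forall x, vertex H x -> exists y, edge H x y
    & forall x y, edge H x y -> exists2 c, is_cycle c & cycle_edge c x y].

Definition is_core K :=
  cyclic_subgraph K /\ forall H, cyclic_subgraph H -> subgraph H K.

End Graphs.

Section CoreExists.
Variables (T : choiceType) (G : graph T).

Let core_rel : rel T :=
  fun x y => `[< exists2 H, cyclic_subgraph G H & edge H x y >].

Let core_sym : symmetric core_rel.
Proof.
suff imp x y : core_rel x y -> core_rel y x.
  by move=> x y; apply/idP/idP; apply: imp.
move=> /asboolP[H cH Hxy]; apply/asboolP.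
by exists H => //; rewrite edge_sym.
Qed.

Let core_irrefl : irreflexive core_rel.
Proof. by move=> x; apply/asboolP => -[H _]; rewrite edge_irrefl. Qed.

Let core_vertex x y : core_rel x y -> [set z | exists w, core_rel z w] x.
Proof. by move=> xy; exists y. Qed.

Lemma core_exists : exists K, is_core G K.
Proof.
exists (Graph core_sym core_irrefl core_vertex); split.
- split=> [|//|x y /asboolP[H [_ _ cH] /cH//]]; split.
  + move=> x [y /asboolP[H [[vH _] _ _] /edge_vertex /vH]]; exact.
  + by move=> x y /asboolP[H [[_ eH] _ _] /eH].
- move=> H cH; split=> [x|x y Hxy].
  + have [_ iH _] := cH => /iH[y Hxy]; exists y.
    by apply/asboolP; exists H.
  + by apply/asboolP; exists H.
Qed.

Lemma core_unique K L : is_core G K -> is_core G L ->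
  vertex K = vertex L /\ edge K =2 edge L.
Proof.
move=> [cK lK] [cL lL]; have [vKL eKL] := lL _ cK; have [vLK eLK] := lK _ cL.
by split; [apply/seteqP | move=> x y; apply/idP/idP; [apply: eKL | apply: eLK]].
Qed.

End CoreExists.

Section ZeroDivisorGraph.
Variable S : comZSemigroupType.

Definition zdg_edge : rel S :=
  fun x y => [&& x != 0, y != 0, x != y & x * y == 0].

Lemma zdg_edge_sym : symmetric zdg_edge.
Proof. by move=> x y; rewrite /zdg_edge andbCA (eq_sym x y) mulgC. Qed.

Lemma zdg_edge_irrefl : irreflexive zdg_edge.
Proof. by move=> x; rewrite /zdg_edge eqxx !andbF. Qed.

Lemma zdg_edge_vertex x y :
  zdg_edge x y -> [set z : S | z != 0 /\ zero_divisor z] x.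
Proof. by case/and4P=> x0 y0 _ /eqP xy0; split=> //; exists y. Qed.

Definition zero_divisor_graph : graph S :=
  Graph zdg_edge_sym zdg_edge_irrefl zdg_edge_vertex.

End ZeroDivisorGraph.

Notation "'Γ' S" := (zero_divisor_graph S) (at level 9, S at level 8).

(* Main.v *)
Require Import Defs.
From mathcomp Require Import all_boot.
From mathcomp Require Import boolp classical_sets functions cardinality.

Set Implicit Arguments.
Unset Strict Implicit.
Unset Printing Implicit Defensive.

Local Open Scope classical_set_scope.
Local Open Scope group_scope.

(** Write T_s for the end vertices adjacent to s. The annihilator of a in T_s
    is contained in {0, s, a}, and nearly everything is a product computed
    inside two such annihilators.

    The pivot is that a t = t for every a in T_s ([end_mul_fix]): a t is
    nonzero and killed by any b in T_t, so it is t or b, and b is impossible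
    because s kills a t but not b. Symmetrically b s = s, whence
    s t = (b s) t = (b t) s = 0. This uses a <> t and b <> s, which is where
    K2 has to be set aside: if t were an end vertex adjacent to s, each of s
    and t would be the only neighbor of the other, and there would
    be no further vertex ([mutual_end_is_K2]).

    Multiplication by t now detects what is needed. Products of elements of T_s
    fix t, so they are neither 0 nor s nor t, and no element of T_s is
    nilpotent. A product a b with b in T_t cannot be s, as then
    (a a) b = a s = 0, so that a a, which fixes t, would lie in {0, t, b},
    all of whose elements kill t. An element s x is killed by a, so it is 0, s
    or a, and it is not a since t kills it.

    Finally, let c = a a' with a, a' in T_s. If c is not an end vertex, it has
    a neighbor y <> s, and a' y, being killed by a, must be s, so that
    t y = (t a') y = t s = 0 and s, c, y, t is a quadrilateral through the edge
    s - t. This contradicts (II); it also puts c in the core, where (I) would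
    give c c = 0 although c c fixes t. *)

(** * Cycles and the core *)

Lemma cycle_edge_sym (T : choiceType) (c : seq T) (x y : T) :
  cycle_edge c x y = cycle_edge c y x.
Proof. by rewrite /cycle_edge andbCA orbC. Qed.

Section Core.
Variables (T : choiceType) (G : graph T).

Let cyclic_rel : rel T := fun x y =>
  edge G x y && `[< exists2 c, is_cycle G c & cycle_edge c x y >].

Let cyclic_rel_sym : symmetric cyclic_rel.
Proof.
move=> x y; rewrite /cyclic_rel edge_sym; congr (_ && _).
by apply/asboolP/asboolP => -[c cG cxy]; exists c => //; rewrite cycle_edge_sym.
Qed.

Let cyclic_rel_irrefl : irreflexive cyclic_rel.
Proof. by move=> x; rewrite /cyclic_rel edge_irrefl. Qed.

Let cyclic_rel_vertex x y :
  cyclic_rel x y -> [set z | exists w, cyclic_rel z w] x.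
Proof. by move=> xy; exists y. Qed.

(** The edges lying on cycles form a cyclic subgraph, so the core, being the
    largest one, has them all. *)
Lemma core_edge (K : graph T) (c : seq T) (x y : T) :
  is_core G K -> is_cycle G c -> cycle_edge c x y -> edge G x y ->
  edge K x y.
Proof.
move=> [_ maxK] cG cxy Gxy.
have cycH :
    cyclic_subgraph G (Graph cyclic_rel_sym cyclic_rel_irrefl cyclic_rel_vertex).
  split=> [|//|u v /andP[_ /asboolP//]]; split=> [u [v /andP[Guv _]]|u v].
  - exact: edge_vertex Guv.
  - by case/andP.
have [_] := maxK _ cycH; apply.
by apply/andP; split=> //; apply/asboolP; exists c.
Qed.

Lemma is_cycle4 (x y z w : T) :
  edge G x y -> edge G y z -> edge G z w -> edge G w x -> x <> z -> y <> w ->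
  is_cycle G [:: x; y; z; w].
Proof.
have neq u v : edge G u v -> u != v.
  by move=> uv; apply: contraTneq uv => ->; rewrite edge_irrefl.
move=> xy yz zw wx /eqP xz /eqP yw; split=> //.
rewrite /ucycle /= xy yz zw wx !inE !negb_or xz yw (neq _ _ xy) (neq _ _ yz).
by rewrite (neq _ _ zw) eq_sym (neq _ _ wx).
Qed.

End Core.

(** * Annihilators of end vertices *)

Section EndVertices.
Variable S : comZSemigroupType.
Implicit Types (a b c s t u x y : S).

Lemma mulg0 x : x * 0 = 0.
Proof. by rewrite mulgC mul0g. Qed.

(** This reduces the degree of a to an annihilator computation; a itself is
    allowed on the right because loops are not edges. *)
Lemma end_neighborsP s a : end_neighbors (Γ S) s a <->
  edge (Γ S) s a /\ forall y, a * y = 0 -> [\/ y = 0, y = s | y = a].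
Proof.
split=> [[sa [_ deg1]]|[sa ann]]; split=> //.
- move=> y ay; have [_ a0 _ _] := and4P sa.
  have [->|y0] := eqVneq y 0; first by constructor 1.
  have [->|ya] := eqVneq y a; first by constructor 3.
  constructor 2; have [f [fI finj _]] := card_set_bijP deg1.
  have Ns : neighbors (Γ S) a s by have := sa; rewrite edge_sym.
  have Ny : neighbors (Γ S) a y.
    by apply/and4P; split; rewrite // ?ay // eq_sym.
  apply: finj; rewrite ?inE //.
  have := fI _ Ny; have := fI _ Ns.
  by rewrite /= !ltnS !leqn0 => /eqP-> /eqP->.
- have as_ : edge (Γ S) a s by rewrite edge_sym.
  split; first exact: edge_vertex as_.
  suff N : neighbors (Γ S) a = [set s] by rewrite /has_degree N card_set1.
  apply/seteqP; split=> [y /and4P[_ /eqP y0 /eqP ay /eqP/ann[]//]|_ ->//].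
  by move=> ya; case: ay.
Qed.

Lemma edgeP x y :
  edge (Γ S) x y <-> [/\ x <> 0, y <> 0, x <> y & x * y = 0].
Proof.
split; first by case/and4P=> /eqP ? /eqP ? /eqP ? /eqP.
by case=> /eqP ? /eqP ? /eqP ? /eqP ?; apply/and4P.
Qed.

(** The annihilators of s and t are both within {0, s, t}. A further x would
    be annihilated by some nonzero z outside them, but z s is a nonzero element
    of the annihilator of s, so x would annihilate s or t. *)
Lemma mutual_end_is_K2 s t : zero_divisor_semigroup S -> s * s = 0 ->
  end_neighbors (Γ S) s t -> end_neighbors (Γ S) t s -> is_K2 (Γ S).
Proof.
move=> zdS ss /end_neighborsP[st annt] /end_neighborsP[_ anns].
have /edgeP[s0 t0 neq_st st0] := st.
have ts0 : t * s = 0 by rewrite mulgC.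
exists s, t; split=> //; apply/seteqP; split=> x /=;
  last by move=> xst; split; [by case: xst => ->; apply/eqP | exact: zdS].
move=> [/eqP x0 _].
apply: contrapT => /not_orP[xs xt].
have xs0 : x * s <> 0 by rewrite mulgC => /anns[].
have xt0 : x * t <> 0 by rewrite mulgC => /annt[].
have [z /eqP z0 xz] := zdS x.
have : s * (z * s) = 0 by rewrite (mulgC z) mulgA ss mul0g.
have xzs : x * (z * s) = 0 by rewrite mulgA xz mul0g.
case/anns=> zs; rewrite zs in xzs => //.
have : s * z = 0 by rewrite mulgC.
by case/anns => zE; rewrite zE in xz.
Qed.

Lemma end_neighbor_neq s t a b : zero_divisor_semigroup S -> ~ is_K2 (Γ S) ->
  s <> t -> s * s = 0 ->
  end_neighbors (Γ S) s a -> end_neighbors (Γ S) t b -> a <> t.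
Proof.
move=> zdS notK2 st ss Ta Tb at_; apply: notK2; rewrite at_ in Ta.
have /end_neighborsP[/edgeP[t0 b0 tb tb0] _] := Tb.
have /end_neighborsP[_ /(_ _ tb0)] := Ta.
by case=> // [bs|bt]; [rewrite bs in Tb; exact: mutual_end_is_K2 Ta Tb | case: tb].
Qed.

Lemma end_mul_fix s t a b : s <> t -> a <> t -> b <> s ->
  end_neighbors (Γ S) s a -> end_neighbors (Γ S) t b -> a * t = t.
Proof.
move=> st at_ bs /end_neighborsP[/edgeP[s0 _ _ sa] anna].
move=> /end_neighborsP[/edgeP[t0 _ _ tb] annb].
have : b * (a * t) = 0 by rewrite mulgC -mulgA tb mulg0.
case/annb => // atE.
- by case: (anna _ atE) => // ?; [case: st | case: at_].
- have : b * s = 0 by rewrite mulgC -atE mulgA sa mul0g.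
  by case/annb => // ?; case: bs.
Qed.

(** * Products of end vertices *)

Lemma end_mul_neighbor s t a b : s * s = 0 -> t * t = 0 ->
  end_neighbors (Γ S) s a -> end_neighbors (Γ S) t b ->
  a * t = t -> b * s = s -> neighbors (Γ S) s (a * b).
Proof.
move=> ss tt /end_neighborsP[/edgeP[s0 _ _ sa] anna].
move=> /end_neighborsP[/edgeP[t0 b0 _ tb] annb] at_ bs.
apply/edgeP; split=> //; last by rewrite mulgA sa mul0g.
- case/anna => // bE; first by case: s0; rewrite -bs bE ss.
  by case: t0; rewrite -at_ -bE mulgC tb.
- move=> sE; have aat : a * a * t = t by rewrite -mulgA !at_.
  have : b * (a * a) = 0 by rewrite mulgC -mulgA -sE mulgC sa.
  case/annb => aaE; case: t0; rewrite -aat aaE ?mul0g //.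
  by rewrite mulgC tb.
Qed.

Lemma end_support_ideal s t a b : end_neighbors (Γ S) s a -> t <> 0 ->
  a * t = t -> b * s = s -> s * t = 0 -> mulset [set s] setT = [set 0; s].
Proof.
move=> /end_neighborsP[/edgeP[s0 _ _ sa] anna] t0 at_ bs st.
apply/seteqP; split=> [_ [_ ->] [x _ <-]|_ [->|->]].
- have : a * (s * x) = 0 by rewrite mulgA (mulgC a) sa mul0g.
  case/anna => sx; [by left|by right|case: t0].
  by rewrite -at_ -sx (mulgC s) -mulgA st mulg0.
- by exists s => //; exists 0 => //; rewrite mulg0.
- by exists s => //; exists b => //; rewrite mulgC.
Qed.

Lemma fixing_not_nilpotent a t : a * t = t -> t <> 0 -> ~ nilpotent a.
Proof.
move=> at_ t0 [n an0]; apply: t0; rewrite -(mul0g t) -an0.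
by elim: n {an0} => [|n IHn] //=; rewrite -mulgA -IHn.
Qed.

(** The square s, a a', y, t is completed by any neighbor y <> s of
    a a', that is, by any y that prevents a a' from being an end vertex. *)
Lemma end_mul_end_or_cycle s t a a' : t <> 0 -> s <> t ->
  s * t = 0 -> t * t = 0 -> a * t = t -> a' * t = t ->
  end_neighbors (Γ S) s a -> end_neighbors (Γ S) s a' ->
  end_neighbors (Γ S) s (a * a') \/
  exists y, is_cycle (Γ S) [:: s; a * a'; y; t].
Proof.
move=> t0 neq_st st tt at_ a't /end_neighborsP[/edgeP[s0 _ _ sa] anna].
move=> /end_neighborsP[_ anna'].
have ct : a * a' * t = t by rewrite -mulgA a't.
have not_kill x u : x * t = t -> u * t = 0 -> x <> u.
  by move=> xt ut xu; apply: t0; rewrite -xt xu.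
have c0 : a * a' <> 0 by apply: not_kill => //; exact: mul0g.
have sc : edge (Γ S) s (a * a').
  apply/edgeP; split=> //; last by rewrite mulgA sa mul0g.
  by apply/nesym; exact: not_kill.
have [ann|] := pselect (forall y, a * a' * y = 0 ->
    [\/ y = 0, y = s | y = a * a']); first by left; apply/end_neighborsP.
move=> /existsNP[y /not_implyP[cy yE]]; right; exists y.
have [y0 ys yc] : [/\ y <> 0, y <> s & y <> a * a'].
  by split=> ye; apply: yE; [constructor 1|constructor 2|constructor 3].
(* The other elements 0 and a of the annihilator of a are excluded because
   they would give a' * a' = 0 and a * a = 0, though both squares fix t. *)
have a'y : a' * y = s.
  have : a * (a' * y) = 0 by rewrite mulgA.
  case/anna => // a'yE.
  - case: (anna' _ a'yE) => // ya'; exfalso.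
    have : a' * a' * t = t by rewrite -mulgA !a't.
    by rewrite -{2}ya' a'yE mul0g => /esym.
  - have : a * a * t = t by rewrite -mulgA !at_.
    by rewrite -{2}a'yE mulgA cy mul0g => /esym.
have yt : y * t = 0 by rewrite -a't mulgA (mulgC y) a'y.
apply: is_cycle4 => //.
- by apply/edgeP; split=> //; apply/nesym.
- apply/edgeP; split=> // ye; apply: neq_st; rewrite -a'y ye.
  exact: a't.
- by apply/edgeP; split=> //; [apply/nesym | rewrite mulgC].
- exact/nesym.
- exact: not_kill.
Qed.

End EndVertices.

Theorem theorem2p9 (S : comZSemigroupType) (hS : zero_divisor_semigroup S)
    (G : graph S) (hG : G = zero_divisor_graph S)
    (hG2 : ~ is_K2 G)
    (K : graph S) (hK : is_core G K)
    (s t : S) (hs : vertex G s) (ht : vertex G t) (hst : s <> t)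
    (hTs : end_neighbors G s !=set0) (hTt : end_neighbors G t !=set0)
    (hs2 : s * s = 0) (ht2 : t * t = 0) :
  [/\ mulset (end_neighbors G s) (end_neighbors G t)
        `<=` neighbors G s `&` neighbors G t,
      mulset [set s] setT = [set 0; s],
      mulset [set t] setT = [set 0; t]
    & (forall u, (neighbors G s `&` vertex K) u -> u * u = 0) \/
      ~ in_quadrilateral G s t ->
      reduced_subsemigroup (end_neighbors G s `|` [set 0])].
Proof.
subst G; have [a0 Ta0] := hTs; have [b0 Tb0] := hTt.
have /nesym hts := hst.
have [/eqP s0 _] := hs; have [/eqP t0 _] := ht.
have fixt a : end_neighbors (Γ S) s a -> a * t = t.
  move=> Ta; apply: (@end_mul_fix S s t a b0) => //.
  - exact: end_neighbor_neq Ta Tb0.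
  - exact: end_neighbor_neq Tb0 Ta.
have fixs b : end_neighbors (Γ S) t b -> b * s = s.
  move=> Tb; apply: (@end_mul_fix S t s b a0) => //.
  - exact: end_neighbor_neq Tb Ta0.
  - exact: end_neighbor_neq Ta0 Tb.
have st : s * t = 0.
  have /end_neighborsP[/edgeP[_ _ _ tb0] _] := Tb0.
  by rewrite -(fixs _ Tb0) -mulgA mulgC -mulgA tb0 mulg0.
have ts : t * s = 0 by rewrite mulgC.
split.
- move=> _ [a Ta] [b Tb <-]; split.
  + exact: end_mul_neighbor Ta Tb (fixt _ Ta) (fixs _ Tb).
  + rewrite mulgC.
    exact: end_mul_neighbor Tb Ta (fixs _ Tb) (fixt _ Ta).
- exact: end_support_ideal Ta0 t0 (fixt _ Ta0) (fixs _ Tb0) st.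
- exact: end_support_ideal Tb0 s0 (fixs _ Tb0) (fixt _ Ta0) ts.
move=> cond; split; first split.
- by exists 0; right.
- move=> x y [Tx|->]; last by rewrite mul0g => _; right.
  move=> [Ty|->]; last by rewrite mulg0; right.
  left; have [//|[z cyc]] := end_mul_end_or_cycle t0 hst st ht2
    (fixt _ Tx) (fixt _ Ty) Tx Ty.
  have [_ /andP[/andP[sc _] uniq_cyc]] := cyc.
  case: cond => [sq0|[]]; last first.
    exists [:: s; x * y; z; t]; split=> //.
    move: uniq_cyc; rewrite /= !inE !negb_or -!andbA andbT.
    case/and4P=> _ _ st_ /and3P[_ ct zt].
    rewrite /cycle_edge /= !inE !eqxx !orbT /= (eq_sym t s) (eq_sym t (x * y)).
    by rewrite (eq_sym t z) (negPf st_) (negPf ct) (negPf zt) !eqxx orbT.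
  have Kc : vertex K (x * y).
    apply: (@edge_vertex _ K _ s); apply: core_edge hK cyc _ _.
      by rewrite /cycle_edge /= !inE !eqxx !orbT.
    by rewrite edge_sym.
  case: t0; have xyt : x * y * t = t by rewrite -mulgA (fixt y) // fixt.
  by rewrite -xyt -xyt mulgA sq0 ?mul0g //; split.
- by right.
- move=> x [Tx|//] nx; case: (fixing_not_nilpotent (fixt _ Tx) t0 nx).
Qed.
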